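(* Let $E$ be an arbitrary graph, $K$ a field, and let $\{H_i\}_{i\in\Lambda}$ be a (nonempty) family of hereditary subsets of $E^0$. Then, in $L_K(E)$: (i) $I\big(\bigcap_{i\in\Lambda}\overline{H_i}\big)=\bigcap_{i\in\Lambda}I(H_i)$. (ii) If $\Lambda$ is finite, then $I\big(\bigcap_{i\in\Lambda}H_i\big)=\bigcap_{i\in\Lambda}I(H_i)$.
   Context: A directed graph is $E=(E^0,E^1,r,s)$ with vertex set $E^0$, edge set $E^1$ and range and source maps $r,s:E^1\to E^0$ (arbitrary). A vertex $v$ is regular if $s^{-1}(v)$ is finite and nonempty. The Leavitt path algebra $L_K(E)$ is the $K$-algebra generated by $E^0\cup E^1\cup\{e^*: e\in E^1\}$ with relations: $vw=\delta_{v,w}v$ for $v,w\in E^0$; $s(e)e=er(e)=e$ and $r(e)e^*=e^*s(e)=e^*$ for $e\in E^1$; $e^*e'=\delta_{e,e'}r(e)$ for $e,e'\in E^1$; and $v=\sum_{s(e)=v}ee^*$ for every regular $v$. $I(Y)$ is the two-sided ideal generated by a set $Y$ of vertices. Write $v\ge w$ if there is a path from $v$ to $w$. $H\subseteq E^0$ is hereditary if $v\in H$ and $v\ge w$ imply $w\in H$. For a hereditary $H$, the saturated closure is $\overline H=\bigcup_{i\ge0}\Lambda_i(H)$, where $\Lambda_0(H)=H$ and $\Lambda_i(H)=\Lambda_{i-1}(H)\cup\{v \text{ regular}: r(s^{-1}(v))\subseteq\Lambda_{i-1}(H)\}$. *)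

(* Defs.v *)
From HB Require Import structures.
From mathcomp Require Import all_boot all_order all_algebra.
From mathcomp Require Import all_classical.
From Stdlib Require List.

Set Implicit Arguments.
Unset Strict Implicit.
Unset Printing Implicit Defensive.

Import GRing.Theory.
Local Open Scope classical_set_scope.
Local Open Scope quotient_scope.
Local Open Scope ring_scope.

Record digraph := Digraph {
  vertex : Type;
  edge : Type;
  src : edge -> vertex;
  rng : edge -> vertex
}.

Section Graph.
Variable E : digraph.

Definition out_edges (v : vertex E) : set (edge E) := src (d:=E) @^-1` [set v].

Definition regular (v : vertex E) : Prop :=
  finite_set (out_edges v) /\ out_edges v !=set0.

Fixpoint is_path (v : vertex E) (p : seq (edge E)) (w : vertex E) : Prop :=
  if p is e :: q then src e = v /\ is_path (rng e) q w else v = w.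

(* [connects v w] is the relation v >= w; the empty path gives v >= v. *)
Definition connects (v w : vertex E) : Prop := exists p, is_path v p w.

Definition hereditary (H : set (vertex E)) : Prop :=
  forall v w, H v -> connects v w -> H w.

Fixpoint saturation_step (H : set (vertex E)) (i : nat) : set (vertex E) :=
  if i is j.+1 then
    saturation_step H j `|`
    [set v | regular v /\ rng (d:=E) @` out_edges v `<=` saturation_step H j]
  else H.

Definition saturated_closure (H : set (vertex E)) : set (vertex E) :=
  \bigcup_i saturation_step H i.

End Graph.

(* L_K(E) is the (in general non-unital) associative K-algebra presented by
   generators and relations.  Since MathComp has no non-unital algebras, it is
   built as the quotient of the algebraic expressions in the generators by the
   least congruence [lpa_eq] containing the axioms of associative K-algebras
   and the defining relations. *)
Inductive lpa_term (K : fieldType) (E : digraph) : Type :=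
| TVertex of vertex E
| TEdge of edge E
| TGhost of edge E
| TZero
| TAdd of lpa_term K E & lpa_term K E
| TOpp of lpa_term K E
| TScale of K & lpa_term K E
| TMul of lpa_term K E & lpa_term K E.

Arguments TVertex {K E}.
Arguments TEdge {K E}.
Arguments TGhost {K E}.
Arguments TZero {K E}.

Section Congruence.
Variables (K : fieldType) (E : digraph).
Implicit Types (x y z : lpa_term K E) (a b : K).
Implicit Types (v w : vertex E) (e f : edge E).

Local Notation Ve := (@TVertex K E).
Local Notation Ed := (@TEdge K E).
Local Notation Gh := (@TGhost K E).

Inductive lpa_eq : lpa_term K E -> lpa_term K E -> Prop :=
| lpa_refl x : lpa_eq x x
| lpa_sym x y : lpa_eq x y -> lpa_eq y x
| lpa_trans x y z : lpa_eq x y -> lpa_eq y z -> lpa_eq x z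
| lpa_congD x x' y y' :
    lpa_eq x x' -> lpa_eq y y' -> lpa_eq (TAdd x y) (TAdd x' y')
| lpa_congN x x' : lpa_eq x x' -> lpa_eq (TOpp x) (TOpp x')
| lpa_congZ a x x' : lpa_eq x x' -> lpa_eq (TScale a x) (TScale a x')
| lpa_congM x x' y y' :
    lpa_eq x x' -> lpa_eq y y' -> lpa_eq (TMul x y) (TMul x' y')
| lpa_addA x y z : lpa_eq (TAdd x (TAdd y z)) (TAdd (TAdd x y) z)
| lpa_addC x y : lpa_eq (TAdd x y) (TAdd y x)
| lpa_add0 x : lpa_eq (TAdd TZero x) x
| lpa_addN x : lpa_eq (TAdd (TOpp x) x) TZero
| lpa_scaleA a b x : lpa_eq (TScale a (TScale b x)) (TScale (a * b) x)
| lpa_scale1 x : lpa_eq (TScale 1 x) x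
| lpa_scaleDr a x y :
    lpa_eq (TScale a (TAdd x y)) (TAdd (TScale a x) (TScale a y))
| lpa_scaleDl a b x :
    lpa_eq (TScale (a + b) x) (TAdd (TScale a x) (TScale b x))
| lpa_mulA x y z : lpa_eq (TMul x (TMul y z)) (TMul (TMul x y) z)
| lpa_mulDl x y z : lpa_eq (TMul (TAdd x y) z) (TAdd (TMul x z) (TMul y z))
| lpa_mulDr x y z : lpa_eq (TMul x (TAdd y z)) (TAdd (TMul x y) (TMul x z))
| lpa_scaleAl a x y : lpa_eq (TScale a (TMul x y)) (TMul (TScale a x) y)
| lpa_scaleAr a x y : lpa_eq (TScale a (TMul x y)) (TMul x (TScale a y))
| lpa_vv v : lpa_eq (TMul (Ve v) (Ve v)) (Ve v)
| lpa_vw v w : v <> w -> lpa_eq (TMul (Ve v) (Ve w)) TZero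
| lpa_src e : lpa_eq (TMul (Ve (src e)) (Ed e)) (Ed e)
| lpa_rng e : lpa_eq (TMul (Ed e) (Ve (rng e))) (Ed e)
| lpa_ghost_rng e : lpa_eq (TMul (Ve (rng e)) (Gh e)) (Gh e)
| lpa_ghost_src e : lpa_eq (TMul (Gh e) (Ve (src e))) (Gh e)
| lpa_ck1_same e : lpa_eq (TMul (Gh e) (Ed e)) (Ve (rng e))
| lpa_ck1_diff e f : e <> f -> lpa_eq (TMul (Gh e) (Ed f)) TZero
(* [es] enumerates s^-1(v) without repetition; all enumerations give the same
   sum up to [lpa_eq]. *)
| lpa_ck2 v (es : seq (edge E)) :
    regular v -> List.NoDup es -> (forall e, List.In e es <-> src e = v) ->
    lpa_eq (Ve v) (foldr (fun e => TAdd (TMul (Ed e) (Gh e))) TZero es).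

HB.instance Definition _ := gen_eqMixin (lpa_term K E).
HB.instance Definition _ := gen_choiceMixin (lpa_term K E).

Definition lpa_eqb x y : bool := `[< lpa_eq x y >].

Lemma lpa_eqb_refl : reflexive lpa_eqb.
Proof. by move=> x; apply/asboolP/lpa_refl. Qed.

Lemma lpa_eqb_sym : symmetric lpa_eqb.
Proof. by move=> x y; apply/asboolP/asboolP => /lpa_sym. Qed.

Lemma lpa_eqb_trans : transitive lpa_eqb.
Proof.
by move=> y x z /asboolP xy /asboolP yz; apply/asboolP/(lpa_trans xy yz).
Qed.

Canonical lpa_equiv :=
  EquivRel lpa_eqb lpa_eqb_refl lpa_eqb_sym lpa_eqb_trans.

Definition leavitt : Type := {eq_quot lpa_equiv}.
HB.instance Definition _ := Choice.on leavitt.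
HB.instance Definition _ := Quotient.on leavitt.

Definition lpa_class (x : lpa_term K E) : leavitt := \pi_leavitt x.

Lemma lpa_classP x y : lpa_class x = lpa_class y <-> lpa_eq x y.
Proof.
split=> [/eqmodP/asboolP //|xy]; exact/eqmodP/asboolP.
Qed.

Lemma lpa_reprP x : lpa_eq (repr (lpa_class x)) x.
Proof. by apply/lpa_classP; rewrite /lpa_class reprK. Qed.

Lemma lpa_classW (P : leavitt -> Prop) :
  (forall x, P (lpa_class x)) -> forall u, P u.
Proof. by move=> Px u; rewrite -[u]reprK; apply: Px. Qed.

Definition leavitt_add (u v : leavitt) := lpa_class (TAdd (repr u) (repr v)).
Definition leavitt_opp (u : leavitt) := lpa_class (TOpp (repr u)).
Definition leavitt_scale a (u : leavitt) := lpa_class (TScale a (repr u)).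
Definition lmul (u v : leavitt) : leavitt :=
  lpa_class (TMul (repr u) (repr v)).

Lemma class_add x y :
  leavitt_add (lpa_class x) (lpa_class y) = lpa_class (TAdd x y).
Proof. by apply/lpa_classP/lpa_congD; apply: lpa_reprP. Qed.

Lemma class_opp x : leavitt_opp (lpa_class x) = lpa_class (TOpp x).
Proof. by apply/lpa_classP/lpa_congN/lpa_reprP. Qed.

Lemma class_scale a x : leavitt_scale a (lpa_class x) = lpa_class (TScale a x).
Proof. by apply/lpa_classP/lpa_congZ/lpa_reprP. Qed.

Lemma class_mul x y : lmul (lpa_class x) (lpa_class y) = lpa_class (TMul x y).
Proof. by apply/lpa_classP/lpa_congM; apply: lpa_reprP. Qed.

Lemma leavitt_addA : associative leavitt_add.
Proof.
elim/lpa_classW=> x; elim/lpa_classW=> y; elim/lpa_classW=> z.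
by rewrite !class_add; apply/lpa_classP/lpa_addA.
Qed.

Lemma leavitt_addC : commutative leavitt_add.
Proof.
elim/lpa_classW=> x; elim/lpa_classW=> y.
by rewrite !class_add; apply/lpa_classP/lpa_addC.
Qed.

Lemma leavitt_add0 : left_id (lpa_class TZero) leavitt_add.
Proof.
by elim/lpa_classW=> x; rewrite !class_add; apply/lpa_classP/lpa_add0.
Qed.

Lemma leavitt_addN : left_inverse (lpa_class TZero) leavitt_opp leavitt_add.
Proof.
elim/lpa_classW=> x.
by rewrite class_opp class_add; apply/lpa_classP/lpa_addN.
Qed.

HB.instance Definition _ := GRing.isZmodule.Build leavitt
  leavitt_addA leavitt_addC leavitt_add0 leavitt_addN.

Lemma leavitt_scaleA a b (u : leavitt) :
  leavitt_scale a (leavitt_scale b u) = leavitt_scale (a * b) u.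
Proof.
elim/lpa_classW: u => x.
by rewrite !class_scale; apply/lpa_classP/lpa_scaleA.
Qed.

Lemma leavitt_scale1 : left_id 1 leavitt_scale.
Proof.
by elim/lpa_classW=> x; rewrite class_scale; apply/lpa_classP/lpa_scale1.
Qed.

Lemma leavitt_scaleDr : right_distributive leavitt_scale +%R.
Proof.
move=> a; elim/lpa_classW=> x; elim/lpa_classW=> y; rewrite /GRing.add /=.
by rewrite !(class_scale, class_add); apply/lpa_classP/lpa_scaleDr.
Qed.

Lemma leavitt_scaleDl (u : leavitt) :
  {morph leavitt_scale^~ u : a b / a + b}.
Proof.
elim/lpa_classW: u => x a b; rewrite [RHS]/GRing.add /=.
by rewrite !(class_scale, class_add); apply/lpa_classP/lpa_scaleDl.
Qed.

HB.instance Definition _ := GRing.Zmodule_isLmodule.Build K leavitt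
  leavitt_scaleA leavitt_scale1 leavitt_scaleDr leavitt_scaleDl.

Lemma lmulA : associative lmul.
Proof.
elim/lpa_classW=> x; elim/lpa_classW=> y; elim/lpa_classW=> z.
by rewrite !class_mul; apply/lpa_classP/lpa_mulA.
Qed.

Lemma lmulDl : left_distributive lmul +%R.
Proof.
elim/lpa_classW=> x; elim/lpa_classW=> y; elim/lpa_classW=> z.
rewrite /GRing.add /= !(class_mul, class_add).
exact/lpa_classP/lpa_mulDl.
Qed.

Lemma lmulDr : right_distributive lmul +%R.
Proof.
elim/lpa_classW=> x; elim/lpa_classW=> y; elim/lpa_classW=> z.
rewrite /GRing.add /= !(class_mul, class_add).
exact/lpa_classP/lpa_mulDr.
Qed.

Lemma lscaleAl a (u v : leavitt) : a *: lmul u v = lmul (a *: u) v.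
Proof.
elim/lpa_classW: u => x; elim/lpa_classW: v => y.
rewrite /GRing.scale /= !(class_mul, class_scale).
exact/lpa_classP/lpa_scaleAl.
Qed.

Lemma lscaleAr a (u v : leavitt) : a *: lmul u v = lmul u (a *: v).
Proof.
elim/lpa_classW: u => x; elim/lpa_classW: v => y.
rewrite /GRing.scale /= !(class_mul, class_scale).
exact/lpa_classP/lpa_scaleAr.
Qed.

(* Two-sided ideals are taken to be K-subspaces.  Every finite subset of
   L_K(E) has a local unit (a finite sum of vertices), so requiring only a
   subgroup would give the same ideals. *)
Definition two_sided_ideal (J : set leavitt) : Prop :=
  [/\ J 0,
      forall x y : leavitt, J x -> J y -> J (x + y),
      forall a (x : leavitt), J x -> J (a *: x),
      forall x y : leavitt, J y -> J (lmul x y) &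
      forall x y : leavitt, J x -> J (lmul x y)].

Definition vertex_ideal (Y : set (vertex E)) : set leavitt :=
  smallest two_sided_ideal [set lpa_class (Ve v) | v in Y].

End Congruence.

Arguments vertex_ideal K {E} Y.

(* Main.v *)
(* By CK2 every element of L_K(E) is a combination of monomials a b^* in which all
   the paths a either have a fixed length N or are shorter and end at a singular
   vertex.  For H hereditary and saturated, L_K(E) acts on the functions on
   {boundary paths of E avoiding H} x Z, where edges shift the integer by 1, and
   I(H) acts by zero.  If x is such a combination and a0 is shortest among the
   paths a with range outside H, the value at a0 p of x applied to the indicator
   of b0 p, for a suitable boundary path p, is the coefficient of a0 b0^* in x.
   Hence a combination lying in I(H) only involves monomials with range in H, so
   one lying in all the I(H_i) only involves monomials with range in the
   intersection of the saturated closures.  This is (i).  For (ii), the saturated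
   closure commutes with finite intersections of hereditary sets, and a set of
   vertices and its saturated closure generate the same ideal. *)
Require Import Defs.
From HB Require Import structures.
From mathcomp Require Import all_boot all_order all_algebra.
From mathcomp Require Import all_classical.
From Stdlib Require List.
Local Open Scope classical_set_scope.

Set Implicit Arguments.
Unset Strict Implicit.
Unset Printing Implicit Defensive.

Import GRing.Theory.
Local Open Scope ring_scope.

(** * Saturated closures *)

(** Supplies the repetition-free enumerations that [lpa_ck2] asks for. *)
Lemma finite_set_NoDup (T : Type) (A : set T) :
  finite_set A ->
  exists s : seq T, List.NoDup s /\ forall x, List.In x s <-> A x.
Proof.
move=> /(@finite_seqP {classic T})[s ->]; exists (undup s); split.
  elim: s => [|x s IHs] /=; first exact: List.NoDup_nil.
  case: ifPn => // /negP xs; apply: List.NoDup_cons IHs => xu; apply: xs.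
  rewrite -mem_undup; elim: (undup s) xu => //= y r IHr [->|/IHr yr].
    by rewrite inE eqxx.
  by rewrite inE yr orbT.
move=> x; rewrite /mkset -mem_undup.
elim: (undup s) => //= y r [IHr IHr']; rewrite inE; split.
  by case=> [->|/IHr ->]; rewrite ?eqxx ?orbT.
by case/orP => [/eqP->|/IHr' ?]; [left | right].
Qed.

(** The maximum of the finitely many indices works. This brings finitely many memberships in
    saturated closures to one common stage. *)
Lemma finite_uniform_index (T : Type) (A : set T) (P : T -> nat -> Prop) :
  finite_set A ->
  (forall x m n, (m <= n)%N -> P x m -> P x n) ->
  (forall x, A x -> exists n, P x n) ->
  exists n, forall x, A x -> P x n.
Proof.
move=> /finite_set_NoDup[s [_ sA]] mono AP.
have {sA} : forall x, A x -> List.In x s by move=> x /sA.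
have {AP} : forall x, List.In x s -> exists n, A x -> P x n.
  move=> x _; case: (pselect (A x)) => [/AP[n Pn]|nA]; first by exists n.
  by exists 0%N.
move=> sP As; suff [n nP] : exists n, forall x, List.In x s -> A x -> P x n.
  by exists n => x Ax; apply: nP (Ax); apply: As.
elim: s sP {As} => [|y s IHs] sP; first by exists 0%N.
have [|n nP] := IHs; first by move=> x xs; apply: sP; right.
have [|m mP] := sP y; first by left.
exists (maxn m n) => x /= [<-|xs] Ax.
  by apply: mono (mP Ax); apply: leq_maxl.
by apply: mono (nP _ xs Ax); apply: leq_maxr.
Qed.

Definition saturated (E : digraph) (H : set (vertex E)) :=
  forall v : vertex E, regular v -> (forall e, src e = v -> H (rng e)) -> H v.

Section Saturation.
Variable E : digraph.
Implicit Types (v w : vertex E) (e : edge E) (H : set (vertex E)).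

Lemma hereditary_edge H e : hereditary H -> H (src e) -> H (rng e).
Proof. by move=> hH He; apply: hH He _; exists [:: e]. Qed.

Lemma saturation_step_mono H m n v :
  (m <= n)%N -> saturation_step H m v -> saturation_step H n v.
Proof.
move=> /subnK <-; elim: (n - m)%N => // k IHk /IHk ?.
by rewrite addSn; left.
Qed.

Lemma saturation_step_rng H n e :
  hereditary H -> saturation_step H n (src e) -> saturation_step H n (rng e).
Proof.
move=> hH; elim: n => [|n IHn] /=; first exact: hereditary_edge.
by case=> [/IHn|[_ sH]]; left => //; apply: sH; exists e.
Qed.

Lemma saturation_step_regular H n v :
  saturation_step H n v -> H v \/ regular v.
Proof. by elim: n => [|n IHn] /=; [left | case=> [/IHn|[? _]]; [|right]]. Qed.

Lemma sub_saturated_closure H : H `<=` saturated_closure H.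
Proof. by move=> v Hv; exists 0%N. Qed.

Lemma saturated_closure_edge H e : hereditary H ->
  saturated_closure H (src e) -> saturated_closure H (rng e).
Proof.
by move=> hH [n _ Hn]; exists n => //; apply: saturation_step_rng.
Qed.

(** A regular vertex has finitely many edges, so one stage contains all their ranges and the next
    stage contains the vertex. *)
Lemma saturated_closure_saturated H : saturated (saturated_closure H).
Proof.
move=> v rv He.
have [n nP] : exists n, forall e, out_edges v e -> saturation_step H n (rng e).
  apply: finite_uniform_index; first by case: rv.
    by move=> e m n; apply: saturation_step_mono.
  by move=> e /He[n _ Hn]; exists n.
by exists n.+1 => //; right; split=> // _ [e /nP ? <-].
Qed.

(** Finiteness gives one stage for all [i], and the induction is on that stage. A vertex outside
    some [H i] is regular, and its edges end one stage earlier for every index, so saturation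
    applies. *)
Lemma bigcap_saturated_closure (I : Type) (H : I -> set (vertex E)) :
  finite_set [set: I] -> (forall i, hereditary (H i)) ->
  \bigcap_(i in [set: I]) saturated_closure (H i) `<=`
    saturated_closure (\bigcap_(i in [set: I]) H i).
Proof.
move=> finI hH v Hv.
have [n nP] : exists n, forall i, [set: I] i -> saturation_step (H i) n v.
  apply: finite_uniform_index => //.
    by move=> i m n; apply: saturation_step_mono.
  by move=> i /Hv[n _ Hn]; exists n.
elim: n v nP {Hv} => [|n IHn] v nP; first by exists 0%N.
case: (pselect (forall i, H i v)) => [Hv|]; first by exists 0%N.
move=> /existsNP[i nHi].
have rv : regular v by case: (saturation_step_regular (nP i Logic.I)).
apply: saturated_closure_saturated rv _ => e ev; apply: IHn => j _.
(* Either [v] was already in stage [n] of [H j], which is hereditary, or it is new and its edges end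
   in stage [n] by definition. *)
case: (nP j Logic.I) => [|[_ sH]]; last by apply: sH; exists e.
by rewrite -ev; apply: saturation_step_rng.
Qed.

End Saturation.

(** * Boundary paths *)

Section Paths.
Variable E : digraph.
Implicit Types (v w : vertex E) (e : edge E) (a b : seq (edge E)).

(** A path is kept as its edges together with its range [w], so that the empty path at [w] has
    origin [w]. *)
Definition origin a w := if a is e :: _ then src e else w.

Definition ends_at a w := is_path (origin a w) a w.

Lemma is_path_origin v a w : is_path v a w -> v = origin a w.
Proof. by case: a => [|e a] //= []. Qed.

Lemma ends_at_cons e a w : ends_at (e :: a) w <-> rng e = origin a w /\ ends_at a w.
Proof.
rewrite /ends_at /=; split=> [[_ pa]|[<- //]].
by have er := is_path_origin pa; rewrite -er.
Qed.

Lemma ends_at_rcons a e w : ends_at (rcons a e) w <-> ends_at a (src e) /\ rng e = w.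
Proof.
elim: a => [|f a IHa] /=.
  by rewrite ends_at_cons /ends_at /=; split=> [[-> _]|[_ ->]].
rewrite !ends_at_cons IHa; have -> : origin (rcons a e) w = origin a (src e).
  by case: a {IHa}.
by split=> [[? []]|[[]]].
Qed.

Lemma hereditary_origin (H : set (vertex E)) a w :
  (forall e, H (src e) -> H (rng e)) -> ends_at a w -> H (origin a w) -> H w.
Proof.
move=> hH; elim: a => [|e a IHa] // /ends_at_cons[er aw] /= /hH.
by rewrite er; apply: IHa.
Qed.

End Paths.

(* A state is a boundary path with a degree.  The boundary paths are the paths of
   E avoiding H which are infinite or stop at a singular vertex; (a, w) encodes
   the path a followed by the path from w given by the chosen edges [next], and
   it is in normal form when a does not end with a chosen edge. *)
Section Boundary.
Variables (E : digraph) (H : set (vertex E)).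
Hypothesis H_edge : forall e : edge E, H (src e) -> H (rng e).
Hypothesis H_saturated : saturated H.
Implicit Types (v w : vertex E) (e : edge E) (a b : seq (edge E)) (n : int).

(** Following [next] from a vertex outside [H] yields one fixed boundary path avoiding [H]:
    saturation provides the edge at each regular vertex. *)
Definition next w : option (edge E) :=
  if pselect (exists e, [/\ regular w, src e = w & ~ H (rng e)]) is left ex
  then Some (projT1 (cid ex)) else None.

Lemma nextP w e : next w = Some e -> [/\ regular w, src e = w & ~ H (rng e)].
Proof. by rewrite /next; case: pselect => // ex [<-]; case: cid. Qed.

Lemma next_regular w : regular w -> ~ H w -> exists e, next w = Some e.
Proof.
move=> rw nHw; rewrite /next; case: pselect => [ex|nex]; first by eexists.
exfalso; apply: nHw; apply: H_saturated => // e ew.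
by apply: contra_notP nex => nHe; exists e.
Qed.

Lemma next_singular w : ~ regular w -> next w = None.
Proof. by case nw: next => [e|//] []; case: (nextP nw). Qed.

Definition state : Type := (seq (edge E) * vertex E * int)%type.
Implicit Types s p q : state.

Definition st s := origin s.1.1 s.1.2.

Definition hd s := if s.1.1 is e :: _ then Some e else next s.1.2.

(** The unchanged state in the last case is a dummy value: [act] consults [tl] only when [hd] is
    [Some e]. *)
Definition tl s : state :=
  match s with
  | (_ :: a, w, n) => (a, w, n - 1)
  | ([::], w, n) => if next w is Some e then ([::], rng e, n - 1) else s
  end.

(** Prefixing a chosen edge to the chosen path from its range is absorbed into the encoding, which
    preserves the normal form. *)
Definition push e s : state :=
  let: (a, w, n) := s in
  if `[< a = [::] /\ next (src e) = Some e >] then ([::], src e, n + 1)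
  else (e :: a, w, n + 1).

Fixpoint reduced a : Prop :=
  if a is e :: b then reduced b /\ ~ (b = [::] /\ next (src e) = Some e)
  else True.

(** Avoiding [H] is asked of the vertex [s.1.2]: the earlier vertices then avoid it since [H] is
    hereditary, the later ones by the choice of [next]. *)
Definition valid s := [/\ ends_at s.1.1 s.1.2, ~ H s.1.2 & reduced s.1.1].

Lemma valid_st s : valid s -> ~ H (st s).
Proof. by case: s => [[a w] n] [/= aw nHw _] /hereditary_origin; auto. Qed.

Lemma valid_nil w n : ~ H w -> valid ([::], w, n). Proof. by split. Qed.

Lemma hd_src s e : hd s = Some e -> src e = st s.
Proof. by case: s => [[[|f a] w] n] => [/nextP[]|[->]]. Qed.

(** With [pushP], this makes [tl] and [push e] inverse bijections between the valid states beginning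
    with [e] and those starting at [rng e]. *)
Lemma tlP s e : valid s -> hd s = Some e ->
  [/\ valid (tl s), st (tl s) = rng e & push e (tl s) = s].
Proof.
case: s => [[[|f a] w] n].
  move=> _; rewrite /hd /= => nw; rewrite nw; have [_ ew nHe] := nextP nw.
  by split=> //=; rewrite ew asboolT // subrK.
move=> [/= /ends_at_cons[fa aw] nHw [ra nfa]] [<-]; split=> //=.
by rewrite asboolF // subrK.
Qed.

Lemma pushP s e : valid s -> st s = rng e ->
  [/\ valid (push e s), st (push e s) = src e, hd (push e s) = Some e
    & tl (push e s) = s].
Proof.
case: s => [[a w] n] vs se; have nHs := valid_st vs.
case: vs => /= aw nHw ra; rewrite /push; case: asboolP => [[a0 ne]|na].
  subst a; rewrite /st /= in se *; rewrite /hd /= ne addrK -se; split=> //.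
  by apply: valid_nil => /H_edge; rewrite -se.
split=> //=; last by rewrite addrK.
by split=> //=; apply/ends_at_cons.
Qed.

(** A boundary path stops only at a singular vertex. Saturation enters here, and CK2 for the action
    rests on it. *)
Lemma hd_regular s : valid s -> regular (st s) -> exists e, hd s = Some e.
Proof.
case: s => [[[|e a] w] n] vs; last by exists e.
by move=> /next_regular; apply; apply: valid_st vs.
Qed.

Lemma push_degree e s : (push e s).2 = s.2 + 1.
Proof. by case: s => [[a w] n] /=; case: ifP. Qed.

Definition pushes a s := foldr push s a.

Lemma pushesP a s : valid s -> ends_at a (st s) ->
  valid (pushes a s) /\ st (pushes a s) = origin a (st s).
Proof.
move=> vs; elim: a => [|e a IHa] //= /ends_at_cons[ea /IHa[va sa]].
by case: (pushP (e := e) va) => //; rewrite sa.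
Qed.

Lemma pushes_degree a s : (pushes a s).2 = s.2 + (size a)%:Z.
Proof.
elim: a => [|e a IHa] /=; first by rewrite addr0.
by rewrite push_degree IHa -addrA -addn1 PoszD.
Qed.

(** Peel off equal first edges. If [b] runs out first, then [q] still begins with an edge of [a],
    against [hd q = None]. *)
Lemma pushes_inj a b p q :
  valid p -> valid q -> ends_at a (st p) -> ends_at b (st q) ->
  pushes a p = pushes b q -> (size b <= size a)%N ->
  size a = size b \/ hd q = None -> a = b /\ p = q.
Proof.
move=> vp vq; elim: a b => [|e a IHa] [|f b] //.
  move=> /ends_at_cons[ea pa] _ /= epq _ [//|]; rewrite -epq.
  have [va sa] := pushesP vp pa.
  by case: (pushP (e := e) va) => [|_ _ ->]; rewrite ?sa.
move=> /ends_at_cons[ea pa] /ends_at_cons[fb qb] /= epq ab h.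
have [va sa] := pushesP vp pa; have [vb sb] := pushesP vq qb.
have [|_ _ h1 t1] := pushP (e := e) va; first by rewrite sa.
have [|_ _ h2 t2] := pushP (e := f) vb; first by rewrite sb.
have [ef] : Some e = Some f by rewrite -h1 -h2 epq.
have eab : pushes a p = pushes b q by rewrite -t1 -t2 epq.
have [|-> ->] := IHa b pa qb eab ab; last by rewrite ef.
by case: h => [[]|]; [left | right].
Qed.

End Boundary.

(** * Monomials *)

Section Algebra.
Variables (K : fieldType) (E : digraph).
Implicit Types (v w : vertex E) (e : edge E) (a b : seq (edge E)).
Implicit Types (x y z : leavitt K E).

Local Notation Ve v := (lpa_class (@TVertex K E v)).
Local Notation Ed e := (lpa_class (@TEdge K E e)).
Local Notation Gh e := (lpa_class (@TGhost K E e)).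

Lemma classD (t u : lpa_term K E) :
  lpa_class (TAdd t u) = lpa_class t + lpa_class u.
Proof. by rewrite -class_add. Qed.

Lemma classZ k (t : lpa_term K E) : lpa_class (TScale k t) = k *: lpa_class t.
Proof. by rewrite -class_scale. Qed.

Lemma classM (t u : lpa_term K E) :
  lpa_class (TMul t u) = lmul (lpa_class t) (lpa_class u).
Proof. by rewrite -class_mul. Qed.

Lemma classN (t : lpa_term K E) : lpa_class (TOpp t) = - lpa_class t.
Proof. by rewrite -class_opp. Qed.

Lemma class0 : lpa_class (@TZero K E) = 0.
Proof. by []. Qed.

Lemma lmul0 x : lmul x 0 = 0.
Proof. by apply: (addrI (lmul x 0)); rewrite -lmulDr !addr0. Qed.

Lemma l0mul x : lmul 0 x = 0.
Proof. by apply: (addrI (lmul 0 x)); rewrite -lmulDl !addr0. Qed.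

Lemma VV v : lmul (Ve v) (Ve v) = Ve v.
Proof. by rewrite -classM; apply/lpa_classP/lpa_vv. Qed.

Lemma VW v w : v <> w -> lmul (Ve v) (Ve w) = 0.
Proof. by move=> vw; rewrite -classM -class0; apply/lpa_classP/lpa_vw. Qed.

Lemma srcE e : lmul (Ve (src e)) (Ed e) = Ed e.
Proof. by rewrite -classM; apply/lpa_classP/lpa_src. Qed.

Lemma rngE e : lmul (Ed e) (Ve (rng e)) = Ed e.
Proof. by rewrite -classM; apply/lpa_classP/lpa_rng. Qed.

Lemma ghost_rngE e : lmul (Ve (rng e)) (Gh e) = Gh e.
Proof. by rewrite -classM; apply/lpa_classP/lpa_ghost_rng. Qed.

Lemma ghost_srcE e : lmul (Gh e) (Ve (src e)) = Gh e.
Proof. by rewrite -classM; apply/lpa_classP/lpa_ghost_src. Qed.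

Lemma ck1_same e : lmul (Gh e) (Ed e) = Ve (rng e).
Proof. by rewrite -classM; apply/lpa_classP/lpa_ck1_same. Qed.

Lemma ck1_diff e f : e <> f -> lmul (Gh e) (Ed f) = 0.
Proof. by move=> ef; rewrite -classM -class0; apply/lpa_classP/lpa_ck1_diff. Qed.

Lemma ck2 v : regular v ->
  exists2 es, (forall e, List.In e es -> src e = v) &
    Ve v = foldr (fun e x => lmul (Ed e) (Gh e) + x) 0 es.
Proof.
move=> rv; have [es [es1 esv]] := finite_set_NoDup (proj1 rv).
exists es => [e /esv //|].
have -> : Ve v =
    lpa_class (foldr (fun e => TAdd (TMul (TEdge e) (TGhost e))) TZero es).
  by apply/lpa_classP/lpa_ck2.
by elim: es {es1 esv} => //= e es IHes; rewrite classD classM IHes.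
Qed.

(** * Ideals generated by vertices *)

Lemma ideal_vertex_ideal (Y : set (vertex E)) :
  two_sided_ideal (vertex_ideal K Y).
Proof.
split=> [J [[]] //|x y Jx Jy J idJ|k x Jx J idJ|x y Jy J idJ|x y Jx J idJ].
- by case: (idJ) => -[_ D _ _ _] _; apply: D; [apply: Jx | apply: Jy].
- by case: (idJ) => -[_ _ Z _ _] _; apply: Z; apply: Jx.
- by case: (idJ) => -[_ _ _ M _] _; apply: M; apply: Jy.
- by case: (idJ) => -[_ _ _ _ M] _; apply: M; apply: Jx.
Qed.

Lemma vertex_ideal_vertex (Y : set (vertex E)) v :
  Y v -> vertex_ideal K Y (Ve v).
Proof. by move=> Yv J [_ YJ]; apply: YJ; exists v. Qed.

Lemma vertex_ideal_min (Y : set (vertex E)) (J : set (leavitt K E)) :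
  two_sided_ideal J -> (forall v, Y v -> J (Ve v)) -> vertex_ideal K Y `<=` J.
Proof. by move=> idJ YJ x; apply; split=> // _ [v /YJ Jv <-]. Qed.

(** By CK2 a vertex added at some stage is the sum of the [e r(e) e^*], where each [r(e)] lies in
    the ideal by induction. *)
Lemma vertex_ideal_closure (Y : set (vertex E)) :
  vertex_ideal K (saturated_closure Y) = vertex_ideal K Y.
Proof.
rewrite eqEsubset; split; apply: vertex_ideal_min;
  try exact: ideal_vertex_ideal; last first.
  by move=> v Yv; apply: vertex_ideal_vertex; apply: sub_saturated_closure.
move=> v [n _]; elim: n v => [|n IHn] v; first exact: vertex_ideal_vertex.
case=> [/IHn //|[rv sY]]; have [es esv ->] := ck2 rv.
have [J0 JD _ JMl JMr] := ideal_vertex_ideal Y.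
elim: es esv => //= e es IHes esv; apply: JD; last first.
  by apply: IHes => f fes; apply: esv; right.
rewrite -ghost_rngE; apply: JMl; apply: JMr; apply: IHn; apply: sY.
by exists e => //; apply: esv; left.
Qed.

(* [Mon a b w] stands for the monomial a w b^* of L_K(E). *)
Inductive mon := Mon of seq (edge E) & seq (edge E) & vertex E.
HB.instance Definition _ := gen_eqMixin mon.

Definition path_mul a x := foldr (fun e y => lmul (Ed e) y) x a.
(** The first edge of [b] is multiplied last, which reverses the order as [b^*] requires. *)
Definition ghost_mul x b := foldr (fun e y => lmul y (Gh e)) x b.
Definition mono (m : mon) := let: Mon a b w := m in
  path_mul a (ghost_mul (Ve w) b).

Definition proper (m : mon) := let: Mon a b w := m in
  ends_at a w /\ ends_at b w.

Lemma ghost_mulA x y b : lmul x (ghost_mul y b) = ghost_mul (lmul x y) b.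
Proof. by elim: b => //= e b <-; rewrite lmulA. Qed.

Lemma vertex_mono v a b w : v = origin a w ->
  lmul (Ve v) (mono (Mon a b w)) = mono (Mon a b w).
Proof.
move=> ->; case: a => [|e a] /=; first by rewrite ghost_mulA VV.
by rewrite lmulA srcE.
Qed.

Lemma vertex_mono0 v a b w : v <> origin a w ->
  lmul (Ve v) (mono (Mon a b w)) = 0.
Proof. by move=> va; rewrite -(vertex_mono _ erefl) lmulA VW // l0mul. Qed.

(** * Spanning by monomials and expansion by CK2 *)

Definition spanned (P : mon -> Prop) x :=
  exists l : seq (K * mon), (forall t, t \in l -> P t.2) /\
    x = \sum_(t <- l) t.1 *: mono t.2.

Lemma spanned0 P : spanned P 0.
Proof. by exists [::]; rewrite big_nil. Qed.

Lemma spannedD P x y : spanned P x -> spanned P y -> spanned P (x + y).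
Proof.
move=> [l [lP ->]] [l' [lP' ->]]; exists (l ++ l'); rewrite big_cat; split=> //.
by move=> t; rewrite mem_cat => /orP[/lP|/lP'].
Qed.

Lemma spannedZ P k x : spanned P x -> spanned P (k *: x).
Proof.
move=> [l [lP ->]]; exists [seq (k * t.1, t.2) | t <- l]; split.
  by move=> _ /mapP[t /lP ? ->].
by rewrite big_map scaler_sumr; apply: eq_bigr => t _; rewrite scalerA.
Qed.

Lemma spanned_mono (P : mon -> Prop) m : P m -> spanned P (mono m).
Proof.
move=> Pm; exists [:: (1, m)]; rewrite big_seq1 scale1r; split=> // t.
by rewrite inE => /eqP ->.
Qed.

Lemma spanned_ind (P : mon -> Prop) (Q : leavitt K E -> Prop) x :
  spanned P x -> Q 0 -> (forall x y, Q x -> Q y -> Q (x + y)) ->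
  (forall k x, Q x -> Q (k *: x)) -> (forall m, P m -> Q (mono m)) ->
  Q x.
Proof.
move=> [l [lP ->]] Q0 QD QZ Qm; rewrite big_seq.
by apply: big_ind => // t /lP /Qm; apply: QZ.
Qed.

Lemma vertex_mono_spanned v m : proper m -> spanned proper (lmul (Ve v) (mono m)).
Proof.
case: m => a b w pm; case: (pselect (v = origin a w)) => [va|va].
  by rewrite vertex_mono //; apply: spanned_mono.
by rewrite vertex_mono0 //; apply: spanned0.
Qed.

(** Each generator sends a proper monomial to a proper monomial or to zero; the other terms follow
    by linearity and associativity. *)
Lemma mul_mono_spanned (t : lpa_term K E) m :
  proper m -> spanned proper (lmul (lpa_class t) (mono m)).
Proof.
elim: t m => [v|e|e||t IHt u IHu|t IHt|k t IHt|t IHt u IHu] m pm.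
- exact: vertex_mono_spanned.
- case: m pm => a b w [aw bw]; rewrite -rngE -lmulA.
  case: (pselect (rng e = origin a w)) => [ea|ea].
    rewrite vertex_mono // (_ : lmul _ _ = mono (Mon (e :: a) b w)) //.
    by apply: spanned_mono; split=> //; apply/ends_at_cons.
  by rewrite vertex_mono0 // lmul0; apply: spanned0.
- case: m pm => [[|f a] b w] [aw bw] /=.
    (* With [a] empty, [e^*] passes to the right part: [e^* w b^*] is the ghost of the path [b e],
       or zero when [w] is not [src e]. *)
    rewrite -ghost_srcE -lmulA ghost_mulA.
    case: (pselect (src e = w)) => [ew|ew].
      rewrite ew VV ghost_mulA -ew ghost_srcE -ghost_rngE.
      rewrite (_ : ghost_mul _ _ = mono (Mon [::] (rcons b e) (rng e))).
        by apply: spanned_mono; split=> //; apply/ends_at_rcons; rewrite ew.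
      by rewrite /= /ghost_mul foldr_rcons.
    rewrite VW //; have -> : ghost_mul 0 b = 0 :> leavitt K E.
      by elim: b {bw} => //= f b ->; rewrite l0mul.
    by rewrite lmul0; apply: spanned0.
  rewrite lmulA; case: (pselect (e = f)) => [<-|ef].
    rewrite ck1_same; apply: (vertex_mono_spanned _ (m := Mon a b w)).
    by split=> //; case/ends_at_cons: aw.
  by rewrite ck1_diff // l0mul; apply: spanned0.
- by rewrite class0 l0mul; apply: spanned0.
- by rewrite classD lmulDl; apply: spannedD; [apply: IHt | apply: IHu].
- rewrite classN -scaleN1r -lscaleAl; apply: spannedZ; exact: IHt.
- by rewrite classZ -lscaleAl; apply: spannedZ; apply: IHt.
- rewrite classM -lmulA; apply: (spanned_ind
    (Q := fun x => spanned proper (lmul (lpa_class t) x)) (IHu _ pm)).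
  + by rewrite lmul0; apply: spanned0.
  + by move=> x y ? ?; rewrite lmulDr; apply: spannedD.
  + by move=> k x ?; rewrite -lscaleAr; apply: spannedZ.
  + exact: IHt.
Qed.

Lemma spanned_proper x : spanned proper x.
Proof.
elim/lpa_classW: x; elim=> [v|e|e||t IHt u IHu|t IHt|k t IHt|t IHt u IHu].
- by apply: (@spanned_mono _ (Mon [::] [::] v)).
- rewrite -rngE; apply: (@spanned_mono _ (Mon [:: e] [::] (rng e))).
  by split=> //; apply/ends_at_cons.
- rewrite -ghost_rngE; apply: (@spanned_mono _ (Mon [::] [:: e] (rng e))).
  by split=> //; apply/ends_at_cons.
- by rewrite class0; apply: spanned0.
- by rewrite classD; apply: spannedD.
- by rewrite classN -scaleN1r; apply: spannedZ.
- by rewrite classZ; apply: spannedZ.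
- rewrite classM; apply: (spanned_ind
    (Q := fun x => spanned proper (lmul (lpa_class t) x)) IHu).
  + by rewrite lmul0; apply: spanned0.
  + by move=> x y ? ?; rewrite lmulDr; apply: spannedD.
  + by move=> k x ?; rewrite -lscaleAr; apply: spannedZ.
  + by move=> m; apply: mul_mono_spanned.
Qed.

Definition expanded N (m : mon) := let: Mon a _ w := m in
  proper m /\ (size a = N \/ (size a <= N)%N /\ ~ regular w).

(** Induction on the missing length [N - size a]. At a regular [w], CK2 splits the monomial into
    those of [a e] and [b e] over the edges [e] leaving [w]; at a singular [w] it is left alone. *)
Lemma expand_mono N a b w : proper (Mon a b w) -> (size a <= N)%N ->
  spanned (expanded N) (mono (Mon a b w)).
Proof.
move=> pm aN; have [k kN] : exists k, k = (N - size a)%N by eexists.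
elim: k a b w pm aN kN => [|k IHk] a b w pm aN kN.
  apply: spanned_mono; split=> //; left; apply/eqP.
  by rewrite eqn_leq aN -subn_eq0 -kN.
case: (pselect (regular w)) => [rw|nrw]; last first.
  by apply: spanned_mono; split=> //; right.
have {aN} aN : (size a < N)%N by rewrite -subn_gt0 -kN.
rewrite /=; have [es esw ->] := ck2 rw; elim: es esw => [_|e es IHes esw] /=.
  suff -> : path_mul a (ghost_mul 0 b) = 0 by apply: spanned0.
  have -> : ghost_mul 0 b = 0 :> leavitt K E.
    by elim: b {pm} => //= f b ->; rewrite l0mul.
  by elim: a {pm aN kN} => //= f a ->; rewrite lmul0.
have -> x y : path_mul a (ghost_mul (x + y) b) =
    path_mul a (ghost_mul x b) + path_mul a (ghost_mul y b).
  rewrite [ghost_mul _ b](_ : _ = ghost_mul x b + ghost_mul y b).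
    by elim: a {pm aN kN IHes} => //= f a ->; rewrite lmulDr.
  by elim: b {pm IHes} => //= f b ->; rewrite lmulDl.
apply: spannedD; last by apply: IHes => f fes; apply: esw; right.
have {esw} ew : src e = w by apply: esw; left.
rewrite -ghost_rngE -ghost_mulA.
rewrite (_ : path_mul _ _ = mono (Mon (rcons a e) (rcons b e) (rng e))).
  case: pm => aw bw; apply: IHk.
  - by split; apply/ends_at_rcons; rewrite ew.
  - by rewrite size_rcons.
  - by rewrite size_rcons subnS -kN.
by rewrite /= /path_mul /ghost_mul !foldr_rcons.
Qed.

Lemma spanned_expanded x : exists N, spanned (expanded N) x.
Proof.
have [l [lP ->]] := spanned_proper x.
pose sz (m : mon) := let: Mon a _ _ := m in size a.
have szN t : t \in l -> (sz t.2 <= \max_(t <- l) sz t.2)%N.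
  by move=> tl; apply: (leq_bigmax_seq t).
move: (\max_(t <- l) sz t.2)%N szN => N szN; exists N; rewrite big_seq.
apply: big_ind; [exact: spanned0 | exact: spannedD | case=> k m tl].
apply: spannedZ; move: (lP _ tl) (szN _ tl).
by case: m {tl} => a b w /= pm aN; apply: expand_mono.
Qed.

End Algebra.

(** * The action on functions on boundary paths *)

Section Action.
Variables (K : fieldType) (E : digraph) (H : set (vertex E)).
Hypothesis H_edge : forall e : edge E, H (src e) -> H (rng e).
Hypothesis H_saturated : saturated H.
Implicit Types (t u : lpa_term K E) (x y : leavitt K E).
Implicit Types (phi psi : state E -> K) (s p q : state E).
Implicit Types (v w : vertex E) (e : edge E) (a b : seq (edge E)).

(** On the indicator of a valid state, an edge prefixes itself and a ghost edge removes itself, with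
    zero when this is impossible. *)
Fixpoint act t phi s : K :=
  match t with
  | TVertex v => if `[< valid H s /\ st s = v >] then phi s else 0
  | TEdge e => if `[< valid H s /\ hd H s = Some e >] then phi (tl H s) else 0
  | TGhost e => if `[< valid H s /\ st s = rng e >] then phi (push H e s) else 0
  | TZero => 0
  | TAdd t u => act t phi s + act u phi s
  | TOpp t => - act t phi s
  | TScale k t => k * act t phi s
  | TMul t u => act t (act u phi) s
  end.

(** Linearity in the function, here and in [actZ], is what [lpa_mulDr] and [lpa_scaleAr] require. *)
Lemma actD t phi psi :
  act t (fun s => phi s + psi s) = (fun s => act t phi s + act t psi s).
Proof.
elim: t phi psi => [v|e|e||t IHt u IHu|t IHt|k t IHt|t IHt u IHu] phi psi;
  apply/funext => s /=; try by [case: asboolP; rewrite ?addr0 | rewrite addr0].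
- by rewrite IHt IHu addrACA.
- by rewrite IHt opprD.
- by rewrite IHt mulrDr.
- by rewrite IHu IHt.
Qed.

Lemma actZ k t phi : act t (fun s => k * phi s) = (fun s => k * act t phi s).
Proof.
elim: t phi => [v|e|e||t IHt u IHu|t IHt|k' t IHt|t IHt u IHu] phi;
  apply/funext => s /=; try by [case: asboolP; rewrite ?mulr0 | rewrite mulr0].
- by rewrite IHt IHu mulrDr.
- by rewrite IHt mulrN.
- by rewrite IHt mulrCA.
- by rewrite IHu IHt.
Qed.

(** Each [e e^*] projects onto the states beginning with [e]; without repetitions at most one
    summand is nonzero at [s]. *)
Lemma act_ck2_sum (es : seq (edge E)) phi s : List.NoDup es ->
  act (foldr (fun e => TAdd (TMul (TEdge e) (TGhost e))) TZero es) phi s =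
  if `[< valid H s /\ exists2 e, hd H s = Some e & List.In e es >]
  then phi s else 0.
Proof.
elim: es => [_|e es IHes] /=; first by rewrite asboolF // => -[_ [e _ []]].
move/List.NoDup_cons_iff => [nes /IHes ->].
case: (pselect (valid H s /\ hd H s = Some e)) => [[vs hs]|ns].
  have [vt st_t pt] := tlP vs hs.
  have ees : exists2 f, hd H s = Some f & e = f \/ List.In f es.
    by exists e => //; left.
  rewrite (asboolT (conj vs hs)) (asboolT (conj vt st_t)) (asboolT (conj vs ees)).
  rewrite pt asboolF ?addr0 // => -[_ [f]]; rewrite hs => -[<-]; exact: nes.
rewrite asboolF // add0r; congr (if _ then _ else _); apply: asbool_equiv_eq.
split=> -[vs [f hf fes]]; split=> //; exists f => //; first by right.
by case: fes => // ef; case: ns; rewrite ef.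
Qed.

(** The action descends to the quotient: CK1 comes from [pushP], CK2 from [act_ck2_sum] and
    [hd_regular]. *)
Lemma act_lpa_eq t u : lpa_eq t u -> act t = act u.
Proof.
elim=> {t u} //=.
- by move=> t u r _ -> _ ->.
- by move=> t t' u u' _ -> _ ->.
- by move=> t t' _ ->.
- by move=> k t t' _ ->.
- by move=> t t' u u' _ -> _ ->.
- by move=> t u r; apply/funext => phi; apply/funext => s; rewrite addrA.
- by move=> t u; apply/funext => phi; apply/funext => s; rewrite addrC.
- by move=> t; apply/funext => phi; apply/funext => s; rewrite add0r.
- by move=> t; apply/funext => phi; apply/funext => s; rewrite addNr.
- by move=> k l t; apply/funext => phi; apply/funext => s; rewrite mulrA.
- by move=> t; apply/funext => phi; apply/funext => s; rewrite mul1r.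
- by move=> k t u; apply/funext => phi; apply/funext => s; rewrite mulrDr.
- by move=> k l t; apply/funext => phi; apply/funext => s; rewrite mulrDl.
- by move=> t u r; apply/funext => phi; rewrite actD.
- by move=> k t u; apply/funext => phi; rewrite actZ.
- by move=> v; apply/funext => phi; apply/funext => s; case: asboolP.
- move=> v w vw; apply/funext => phi; apply/funext => s.
  by case: asboolP => // -[_ ->]; rewrite asboolF // => -[].
- move=> e; apply/funext => phi; apply/funext => s.
  case: asboolP => [//|n1]; rewrite asboolF // => -[vs hs]; apply: n1.
  by rewrite (hd_src hs).
- move=> e; apply/funext => phi; apply/funext => s.
  case: asboolP => [[vs hs]|//]; have [vt se _] := tlP vs hs.
  by rewrite asboolT.
- move=> e; apply/funext => phi; apply/funext => s.
  by case: asboolP.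
- move=> e; apply/funext => phi; apply/funext => s.
  case: asboolP => [[vs se]|//].
  by have [vp sp _ _] := pushP H_edge vs se; rewrite asboolT.
- move=> e; apply/funext => phi; apply/funext => s.
  case: asboolP => [[vs se]|//].
  by have [vp sp hp tp] := pushP H_edge vs se; rewrite asboolT // tp.
- move=> e f ef; apply/funext => phi; apply/funext => s.
  case: asboolP => [[vs se]|//].
  have [vp sp hp tp] := pushP H_edge vs se.
  by rewrite asboolF // => -[_]; rewrite hp => -[].
- move=> v es rv es1 esv; apply/funext => phi; apply/funext => s.
  rewrite act_ck2_sum //; congr (if _ then _ else _); apply: asbool_equiv_eq.
  split=> -[vs].
    move=> sv; split=> //; rewrite -sv in rv.
    have [e hs] := hd_regular H_edge H_saturated vs rv; exists e => //.
    by apply/esv; rewrite (hd_src hs).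
  by case=> e hs /esv <-; rewrite (hd_src hs).
Qed.

Definition lact x := act (repr x).

Lemma lact_class t : lact (lpa_class t) = act t.
Proof. exact/act_lpa_eq/lpa_reprP. Qed.

Lemma lactD x y phi s : lact (x + y) phi s = lact x phi s + lact y phi s.
Proof.
elim/lpa_classW: x => t; elim/lpa_classW: y => u.
by rewrite -classD !lact_class.
Qed.

Lemma lactZ k x phi s : lact (k *: x) phi s = k * lact x phi s.
Proof. by elim/lpa_classW: x => t; rewrite -classZ !lact_class. Qed.

Lemma lactM x y phi : lact (lmul x y) phi = lact x (lact y phi).
Proof.
elim/lpa_classW: x => t; elim/lpa_classW: y => u.
by rewrite -classM !lact_class.
Qed.

Lemma lact0 phi s : lact 0 phi s = 0.
Proof. by rewrite -class0 lact_class. Qed.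

Lemma lact_phi0 x s : lact x (fun=> 0) s = 0.
Proof.
have e0 : (fun=> 0) = (fun=> 0 * 0) :> (state E -> K).
  by apply/funext => ?; rewrite mul0r.
by rewrite /lact e0 actZ mul0r.
Qed.

Lemma lact_sum (T : Type) (l : seq T) (F : T -> leavitt K E) phi s :
  lact (\sum_(i <- l) F i) phi s = \sum_(i <- l) lact (F i) phi s.
Proof.
by apply: (big_morph (fun x => lact x phi s)) => [x y|]; rewrite ?lactD ?lact0.
Qed.

(** The elements acting by zero form a two-sided ideal, and it contains [H] because no valid state
    starts in [H]. *)
Lemma vertex_ideal_annihilates x phi s : vertex_ideal K H x -> lact x phi s = 0.
Proof.
pose J := [set x | forall phi s, lact x phi s = 0].
suff : vertex_ideal K H `<=` J by move=> HJ /HJ; apply.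
apply: vertex_ideal_min => [|v Hv psi q]; last first.
  rewrite lact_class /= asboolF // => -[/(valid_st H_edge) nH qv].
  by apply: nH; rewrite qv.
split=> [psi q|y z Jy Jz psi q|k y Jy psi q|y z Jz psi q|y z Jy psi q].
- exact: lact0.
- by rewrite lactD Jy Jz addr0.
- by rewrite lactZ Jy mulr0.
- rewrite lactM (_ : lact z psi = fun=> 0) ?lact_phi0 //.
  by apply/funext => r; apply: Jz.
- by rewrite lactM Jy.
Qed.

(** * Action of monomials on test functions *)

Lemma lact_ghost_mul w b phi s : ends_at b w ->
  lact (ghost_mul (lpa_class (TVertex w)) b) phi s =
  if `[< valid H s /\ st s = w >] then phi (pushes H b s) else 0.
Proof.
elim: b phi => [|e b IHb] phi /=; first by rewrite lact_class.
move=> /ends_at_cons[eb bw]; rewrite lactM IHb //; case: asboolP => // -[vs sw].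
rewrite lact_class /= asboolT //.
by rewrite eb -sw; apply: pushesP => //; rewrite sw.
Qed.

Lemma lact_path_mul a x phi p : valid H p -> ends_at a (st p) ->
  lact (path_mul a x) phi (pushes H a p) = lact x phi p.
Proof.
move=> vp; elim: a => //= e a IHa /ends_at_cons[ea ap].
have [va sa] := pushesP H_edge vp ap.
have [|vq sq hq tq] := pushP (e := e) H_edge va; first by rewrite sa.
by rewrite lactM lact_class /= asboolT // tq IHa.
Qed.

Lemma lact_path_mul_neq0 a x phi s : lact (path_mul a x) phi s <> 0 ->
  exists2 p, s = pushes H a p & lact x phi p = lact (path_mul a x) phi s.
Proof.
elim: a s => [|e a IHa] s /=; first by exists s.
rewrite lactM lact_class /=; case: asboolP => // -[vs hs] /IHa[p tp <-].
by exists p => //; rewrite -tp; have [] := tlP vs hs.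
Qed.

(* Test functions concentrated at the single state b0 p, evaluated at a0 p,
   isolate the monomial a0 w0 b0^* : the range component decides a, and the
   degree then decides b. *)
Lemma lact_mono a b w a0 b0 p : valid H p ->
  proper (Mon a b w) -> proper (Mon a0 b0 (st p)) ->
  (size a0 <= size a)%N -> size a = size a0 \/ hd H p = None ->
  lact (mono K (Mon a b w)) (fun s => (`[< s = pushes H b0 p >])%:R)
    (pushes H a0 p) = (Mon a b w == Mon a0 b0 (st p))%:R.
Proof.
move=> vp [aw bw] [a0p b0p] a0a h; set phi := fun s => _; rewrite /mono.
have [/eqP[-> -> ->]|ne] := boolP (_ == _).
  rewrite lact_path_mul // lact_ghost_mul // asboolT // /phi.
  by rewrite asboolT.
(* A nonzero value means that [a0 p] is also [a q] for some [q] starting at [w], and the test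
   function then forces [b q = b0 p]. *)
case: (pselect (lact (path_mul a (ghost_mul (lpa_class (TVertex w)) b)) phi
  (pushes H a0 p) = 0)) => [//|/lact_path_mul_neq0[q pq <-]].
rewrite lact_ghost_mul //; case: asboolP => // -[vq qw].
rewrite /phi; case: asboolP => // qp; case/negP: ne.
rewrite -qw in aw bw.
have [ea eq] := pushes_inj H_edge vq vp aw a0p (esym pq) a0a h.
(* The integer coordinate is needed here: a cycle prefixed to its own infinite power gives the same
   path in a different degree. *)
subst a q; have eb : size b = size b0.
  by move: (congr1 snd qp); rewrite !pushes_degree => /addrI [].
have b0b : (size b0 <= size b)%N by rewrite eb.
have [-> _] := pushes_inj H_edge vp vp bw b0p qp b0b (or_introl eb).
by rewrite qw.
Qed.

End Action.

(** * Intersections *)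

Section Coefficients.
Variables (K : fieldType) (E : digraph) (H : set (vertex E)).
Hypothesis H_hereditary : hereditary H.

Definition mon_rng (m : mon E) := let: Mon _ _ w := m in w.
Definition mon_size (m : mon E) := let: Mon a _ _ := m in size a.

Lemma vertex_ideal_mono (Y : set (vertex E)) m :
  Y (mon_rng m) -> vertex_ideal K Y (mono K m).
Proof.
case: m => a b w /= Yw; have [_ _ _ JMl JMr] := ideal_vertex_ideal K Y.
have Jb : vertex_ideal K Y (ghost_mul (lpa_class (TVertex w)) b).
  elim: b => [|e b IHb] /=; first exact: vertex_ideal_vertex.
  exact: JMr.
by elim: a => //= e a IHa; apply: JMl.
Qed.

(** The combination acts by zero; at the test point, terms with range in the closure vanish and the
    others give a Kronecker delta by [lact_mono]. The sum collects repeated occurrences of [m0]. *)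
Lemma coefficient_eq0 N (l : seq (K * mon E)) m0 :
  (forall t, t \in l -> expanded N t.2) ->
  vertex_ideal K H (\sum_(t <- l) t.1 *: mono K t.2) ->
  m0 \in [seq t.2 | t <- l] -> ~ saturated_closure H (mon_rng m0) ->
  (forall t, t \in l -> ~ saturated_closure H (mon_rng t.2) ->
    (mon_size m0 <= mon_size t.2)%N) ->
  \sum_(t <- l | t.2 == m0) t.1 = 0.
Proof.
set cH := saturated_closure H.
move=> lN; rewrite -vertex_ideal_closure -/cH => Jl m0l nH m0min.
have cH_edge : forall e, cH (src e) -> cH (rng e).
  by move=> e; apply: saturated_closure_edge.
have cH_sat : saturated cH by apply: saturated_closure_saturated.
have [t0 t0l em0] := mapP m0l; have := lN _ t0l; rewrite -em0 {t0 t0l em0}.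
case: m0 nH m0min m0l => a0 b0 w0 /= nH m0min _ [pm0 a0N].
(* The boundary path of chosen edges from [w0], which is empty if [w0] is singular. *)
pose p : state E := ([::], w0, 0).
have vp : valid cH p by apply: valid_nil.
pose phi : state E -> K := fun s => (`[< s = pushes cH b0 p >])%:R.
have := vertex_ideal_annihilates cH_edge cH_sat phi (pushes cH a0 p) Jl.
rewrite (lact_sum cH_edge cH_sat) => sum0; rewrite -[RHS]sum0 [LHS]big_mkcond.
apply: eq_big_seq => -[k m] tl /=; rewrite (lactZ cH_edge cH_sat).
have := lN _ tl; have := m0min _ tl; case: m tl => a b w tl /= amin [pm aN].
case: (pselect (cH w)) => [Hw|nHw].
  rewrite (vertex_ideal_annihilates cH_edge cH_sat) ?mulr0 //; last first.
    exact: (vertex_ideal_mono (m := Mon a b w)).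
  by case: eqP => // -[_ _ ww0]; case: nH; rewrite -ww0.
rewrite (lact_mono _ cH_edge cH_sat) //; last 2 first.
- exact: amin.
(* If [a0] has length [N], minimality and the bound [N] give equal lengths; otherwise [w0] is
   singular and [p] has no first edge. *)
- case: a0N => [a0N|[_ /next_singular nw0]]; last first.
    by right; rewrite /hd /= nw0.
  left; apply/eqP; rewrite eqn_leq amin // a0N andbT.
  by case: aN => [->|[-> _]].
by case: eqP; rewrite ?mulr1 ?mulr0.
Qed.

End Coefficients.

Section Intersection.
Variables (K : fieldType) (E : digraph) (I : Type) (H : I -> set (vertex E)).
Hypothesis H_hereditary : forall i, hereditary (H i).

(** Induction on the number of terms. If some range lies outside the closure of [H i], a shortest
    such monomial has total coefficient zero, so all its occurrences can be deleted without changing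
    the element. *)
Lemma bigcap_vertex_ideal_sub :
  \bigcap_(i in [set: I]) vertex_ideal K (H i) `<=`
    vertex_ideal K (\bigcap_(i in [set: I]) saturated_closure (H i)).
Proof.
move=> x Hx; have [N [l [lN xl]]] := spanned_expanded x; subst x.
have [n ln] : exists n, (size l <= n)%N by exists (size l).
elim: n l ln lN Hx => [|n IHn] l ln lN Hx.
  case: l ln {lN Hx} => // _; rewrite big_nil.
  by case: (ideal_vertex_ideal K
    (\bigcap_(i in [set: I]) saturated_closure (H i))).
set J := vertex_ideal K _.
have [J0 JD JZ _ _] : two_sided_ideal J by apply: ideal_vertex_ideal.
case: (pselect (forall t, t \in l -> forall i,
    saturated_closure (H i) (mon_rng t.2))) => [lH|].
  rewrite big_seq; apply: big_ind => // t /lH tH; apply: JZ.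
  by apply: vertex_ideal_mono => i _.
move=> /existsNP[t /not_implyP[tl /existsNP[i nHt]]].
pose bad k := has (fun u : K * mon E =>
  `[< ~ saturated_closure (H i) (mon_rng u.2) >] && (mon_size u.2 == k)) l.
have exbad : exists k, bad k.
  by exists (mon_size t.2); apply/hasP; exists t => //; rewrite eqxx asboolT.
case: (ex_minnP exbad) => _ /hasP[[k0 m0] m0l /andP[/asboolP nHm0 /eqP <-]] m0min.
have coef0 : \sum_(u <- l | u.2 == m0) u.1 = 0.
  apply: (coefficient_eq0 (@H_hereditary i) lN) => //.
  - exact: Hx.
  - by apply/mapP; exists (k0, m0).
  - by move=> u ul nHu; apply: m0min; apply/hasP; exists u; rewrite ?asboolT ?eqxx.
pose l' := [seq u <- l | u.2 != m0].
have el : \sum_(u <- l) u.1 *: mono K u.2 = \sum_(u <- l') u.1 *: mono K u.2.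
  rewrite (bigID (fun u : K * mon E => u.2 == m0)) /= big_filter.
  rewrite (eq_bigr (fun u : K * mon E => u.1 *: mono K m0)).
    by rewrite -scaler_suml coef0 scale0r add0r.
  by move=> u /eqP ->.
rewrite el; apply: IHn.
- rewrite -ltnS; apply: leq_trans ln; rewrite size_filter.
  rewrite -(count_predC (fun u : K * mon E => u.2 == m0)) -add1n leq_add2r.
  by rewrite -has_count; apply/hasP; exists (k0, m0); rewrite /= ?eqxx.
- by move=> u; rewrite mem_filter => /andP[_ /lN].
- by rewrite -el.
Qed.

Lemma bigcap_vertex_ideal :
  vertex_ideal K (\bigcap_(i in [set: I]) saturated_closure (H i)) =
    \bigcap_(i in [set: I]) vertex_ideal K (H i).
Proof.
rewrite eqEsubset; split; last exact: bigcap_vertex_ideal_sub.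
move=> x Jx i _; rewrite -vertex_ideal_closure; move: x Jx.
apply: vertex_ideal_min; first exact: ideal_vertex_ideal.
by move=> v Hv; apply: vertex_ideal_vertex; apply: Hv.
Qed.

End Intersection.

Theorem lemma1p7 (K : fieldType) (E : digraph) (I : Type)
    (H : I -> set (vertex E)) (I_nonempty : inhabited I)
    (H_hereditary : forall i : I, hereditary (H i)) :
  vertex_ideal K (\bigcap_(i in [set: I]) saturated_closure (H i)) =
    \bigcap_(i in [set: I]) vertex_ideal K (H i)
  /\
  (finite_set [set: I] ->
    vertex_ideal K (\bigcap_(i in [set: I]) H i) =
      \bigcap_(i in [set: I]) vertex_ideal K (H i)).
Proof.
split=> [|finI]; first exact: bigcap_vertex_ideal.
rewrite -bigcap_vertex_ideal // eqEsubset; split.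
  apply: vertex_ideal_min; first exact: ideal_vertex_ideal.
  move=> v Hv; apply: vertex_ideal_vertex => i /Hv.
  exact: sub_saturated_closure.
(* Passing to the saturated closure of the intersection leaves the ideal unchanged and makes room
   for [bigcap_saturated_closure]. *)
rewrite -(vertex_ideal_closure K (\bigcap_(i in [set: I]) H i)).
apply: vertex_ideal_min; first exact: ideal_vertex_ideal.
move=> v Hv; apply: vertex_ideal_vertex.
exact: bigcap_saturated_closure Hv.
Qed.
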